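(* Let $h$ be a polynomial of fixed degree $N$ of the form $h(x)=\prod_{j=1}^M(x-c_j)^{M_j+1}$, let $\mathcal{U}$ be a quasi-definite vector of linear functionals, and let $\widetilde{\mathcal{U}}=\mathcal{U}+\Lambda\,\boldsymbol{\delta}$ be quasi-definite. Let $\mathcal{F}$ and $\widetilde{\mathcal{F}}$ be the generalized Markov functions associated with $\mathcal{U}$ and $\widetilde{\mathcal{U}}$, respectively. Then $$z\widetilde{\mathcal{F}}(z)=z\mathcal{F}(z)+\boldsymbol{\delta}_x(\mathcal{P}_0(x))\,\Lambda^T.$$
   Context: The points $c_1,\dots,c_M$ are the distinct zeros of $h$, with multiplicities $M_j+1$, so $N=M+\sum_{j=1}^MM_j$. Put $\mathcal{P}_0(x)=[1,x,\dots,x^{N-1}]^T$, $\mathcal{P}_j=h^j\mathcal{P}_0$. A vector of linear functionals $\mathcal{U}=[u^1,\dots,u^N]^T$ consists of linear functionals on $\mathbb{C}[x]$; for $\mathcal{P}=[p_1,\dots,p_N]^T$, $\mathcal{U}(\mathcal{P})$ is the $N\times N$ matrix with $(i,j)$ entry $\langle u^j,p_i\rangle$. With $\mathcal{U}_j=\mathcal{U}(\mathcal{P}_j)$, $\mathcal{U}$ is quasi-definite if all leading principal submatrices of $[\mathcal{U}_{i+j}]_{i,j=0}^m$, $m\in\mathbb{N}$, are non-singular. Subscripts ($\mathcal{U}_x$, $\boldsymbol{\delta}_x$) indicate the variable acted on. The generalized Markov function associated with $\mathcal{U}$ is $\mathcal{F}(z)=\mathcal{U}_x\left(\frac{\mathcal{P}_0(x)}{z-h(x)}\right)=\sum_{k\ge0}\mathcal{U}(h^k\mathcal{P}_0)\,z^{-k-1}$,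 for $z$ with $|h(x)|<|z|$ for every $x\in\bigcup_j\operatorname{supp}u^j$ (and similarly for $\widetilde{\mathcal{U}}$). $\Lambda$ is a numerical $N\times N$ matrix, $\boldsymbol{\delta}=[\delta_{c_1},\delta'_{c_1},\dots,\delta^{(M_1)}_{c_1},\dots,\delta_{c_M},\delta'_{c_M},\dots,\delta^{(M_M)}_{c_M}]^T$, where $\langle\delta_c^{(i)},p\rangle=(-1)^ip^{(i)}(c)$, and $(\Lambda\boldsymbol{\delta})(\mathcal{P})=\boldsymbol{\delta}(\mathcal{P})\Lambda^T$. *)

(* Defs.v *)
(* MathComp / MathComp-Analysis; the complex numbers are R[i], R : realType. *)
From HB Require Import structures.
From mathcomp Require Import all_boot all_order all_algebra.
From mathcomp Require Import complex.
From mathcomp Require Import all_classical all_reals all_analysis.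

Set Implicit Arguments.
Unset Strict Implicit.
Unset Printing Implicit Defensive.

Import Order.TTheory GRing.Theory Num.Theory.
Import numFieldNormedType.Exports.

Local Open Scope classical_set_scope.
Local Open Scope ring_scope.

Section Functionals.
Variable F : fieldType.

(* Vectors of linear functionals are families U : 'I_N -> {scalar {poly F}}. *)

Definition dirac_deriv (c : F) (i : nat) (p : {poly F}) : F :=
  (-1) ^+ i * (p^`(i)).[c].

Lemma dirac_deriv_linear c i : scalar (dirac_deriv c i).
Proof.
by move=> a p q; rewrite /dirac_deriv derivnD derivnZ hornerD hornerZ mulrDr mulrCA.
Qed.

HB.instance Definition _ c i :=
  GRing.isLinear.Build F {poly F} F _ (dirac_deriv c i) (dirac_deriv_linear c i).

Definition lincomb n (a : 'I_n -> F) (V : 'I_n -> {scalar {poly F}})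
  (p : {poly F}) : F := \sum_k a k * V k p.

Lemma lincomb_linear n a V : scalar (@lincomb n a V).
Proof.
move=> b p q; rewrite /lincomb mulr_sumr -big_split; apply: eq_bigr => k _ /=.
by rewrite linearP mulrDr mulrCA.
Qed.

HB.instance Definition _ n a V :=
  GRing.isLinear.Build F {poly F} F _ (@lincomb n a V) (lincomb_linear a V).

Definition addfun_vec N (U V : 'I_N -> {scalar {poly F}}) :
  'I_N -> {scalar {poly F}} := fun i => U i \+ V i.

Definition mulmx_vec m N (L : 'M[F]_(m, N)) (V : 'I_N -> {scalar {poly F}}) :
  'I_m -> {scalar {poly F}} := fun i => lincomb (L i) V.

(* The matrix U(P); the functional index is the column index. *)
Definition apply_vec N (U : 'I_N -> {scalar {poly F}}) (P : 'I_N -> {poly F}) :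
  'M[F]_N := \matrix_(i, j) U j (P i).

Definition calP N (h : {poly F}) (j : nat) : 'I_N -> {poly F} :=
  fun i => h ^+ j * 'X^i.

Definition leading_principal n k (le_kn : (k <= n)%N) (A : 'M[F]_n) : 'M[F]_k :=
  mxsub (widen_ord le_kn) (widen_ord le_kn) A.

(* The leading principal submatrices are those of the scalar matrix obtained
   by flattening the block Hankel matrix, in every size k, not only the sizes
   that are multiples of N. *)
Definition block_hankel N (h : {poly F}) (U : 'I_N -> {scalar {poly F}})
  (m : nat) : 'M[F]_(\sum_(i < m.+1) N) :=
  \mxblock_(i < m.+1, j < m.+1) apply_vec U (calP h (i + j)).

Definition quasi_definite N (h : {poly F}) (U : 'I_N -> {scalar {poly F}}) :=
  forall (m k : nat) (le_k : (k <= \sum_(i < m.+1) N)%N),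
    leading_principal le_k (block_hankel h U m) \in unitmx.

(* tagnat.sig1 / tagnat.sig2 enumerate the pairs (j, i), i <= mu j, in
   lexicographic order, so that the functionals at one point are contiguous. *)
Definition delta_vec M (c : 'I_M -> F) (mu : 'I_M -> nat) :
  'I_(\sum_(j < M) (mu j).+1) -> {scalar {poly F}} :=
  fun k => dirac_deriv (c (tagnat.sig1 k)) (tagnat.sig2 k).

End Functionals.

Arguments delta_vec {F M} c mu _.

Section Markov.
Variable R : realType.
Local Notation C := R[i].

(* A functional on polynomials does not determine a subset of the plane by
   itself.  S is an admissible support of u when S is compact and u is
   continuous for uniform convergence on each neighbourhood of S (S carries u,
   as for analytic functionals).  This holds for integration against a measure
   with compact support S, for the derivatives of a Dirac mass at c with
   S = {c}, and for distributions with compact support S. *)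
Definition is_support (S : set C^o) (u : {scalar {poly C}}) : Prop :=
  compact S /\
  forall V : set C^o, open V -> S `<=` V ->
    exists A : C, forall (p : {poly C}) (B : C), 0 <= B ->
      (forall x, V x -> `|p.[x]| <= B) -> `|u p| <= A * B.

Definition markov_domain N (h : {poly C}) (U : 'I_N -> {scalar {poly C}}) :
  set C :=
  [set z | exists S : 'I_N -> set C^o,
    (forall j, is_support (S j) (U j)) /\
    (forall j x, S j x -> `|h.[x]| < `|z|)].

Definition markov_coef N (h : {poly C}) (U : 'I_N -> {scalar {poly C}})
  (k : nat) : 'M[C]_N := apply_vec U (calP h k).

(* C^o carries the usual topology of the complex plane. *)
Definition markov_partial N (h : {poly C}) (U : 'I_N -> {scalar {poly C}})
  (z : C) (i j : 'I_N) : nat -> C^o :=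
  fun n => \sum_(0 <= k < n) z ^- k.+1 * markov_coef h U k i j.

Definition markov_cvg N (h : {poly C}) (U : 'I_N -> {scalar {poly C}}) (z : C) :=
  forall i j, cvgn (markov_partial h U z i j).

Definition markov_fun N (h : {poly C}) (U : 'I_N -> {scalar {poly C}}) (z : C) :
  'M[C]_N := \matrix_(i, j) limn (markov_partial h U z i j).

End Markov.

(* Main.v *)
Require Import Defs.
From HB Require Import structures.
From mathcomp Require Import all_boot all_order all_algebra.
From mathcomp Require Import complex.
From mathcomp Require Import all_classical all_reals all_analysis.

Set Implicit Arguments.
Unset Strict Implicit.
Unset Printing Implicit Defensive.

Import Order.TTheory GRing.Theory Num.Theory.
Import numFieldNormedType.Exports.

Local Open Scope classical_set_scope.
Local Open Scope ring_scope.



(** Applied to the polynomials [h ^ k x ^ i], the perturbation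
    [Lambda delta] contributes the matrix [delta (h ^ k P_0) Lambda^T].  At each
    root [c_j] of [h] the vector [delta] only takes derivatives of order at
    most [mu j], while [h ^ k] vanishes there to order at least [(mu j).+1] as
    soon as [k > 0] (dirac_deriv_XsubC_expM, delta_vec_calPS).  So the two
    Markov series have the same coefficients except the first, and they differ
    by the single term [z^-1 delta (P_0) Lambda^T].

    To turn this identity of series into one of functions, both series must
    converge on the domain.  If [u] is carried by a compact set [S] on which
    [|h| < |z|], then [|h|] attains a maximum on [S] and is bounded by some
    [q < |z|] on a neighbourhood of [S]; continuity of [u] on that neighbourhood
    gives [|u (h ^ k p)| <= A q ^ k] (support_geometric_bound), and the series
    is dominated by a geometric series of ratio [q / |z|].  Real and
    imaginary parts reduce the convergence to that of real series.

    The point [z = 0] is in the domain only if every carrier is empty; then the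
    functionals vanish (is_support0), hence so does [delta (P_0) Lambda^T],
    and both sides of the identity are zero. *)

(** * The Dirac functionals vanish on multiples of h *)

Lemma deriv_XsubC_expM (F : comNzRingType) (c : F) n (q : {poly F}) :
  (('X - c%:P) ^+ n.+1 * q)^`() =
  ('X - c%:P) ^+ n * (q *+ n.+1 + ('X - c%:P) * q^`()).
Proof.
rewrite derivM deriv_exp derivXsubC mul1r.
by rewrite mulrDr mulrnAl mulrnAr exprSr mulrA.
Qed.

(** Differentiating lowers the order of the zero at [c] by at most one, so fewer
    than [n] derivatives leave a factor ['X - c]. *)
Lemma dirac_deriv_XsubC_expM (F : fieldType) (c : F) i n (q : {poly F}) :
  (i < n)%N -> dirac_deriv c i (('X - c%:P) ^+ n * q) = 0.
Proof.
case: n => // n; rewrite ltnS /dirac_deriv => le_in.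
suff -> : ((('X - c%:P) ^+ n.+1 * q)^`(i)).[c] = 0 by rewrite mulr0.
elim: i n q le_in => [|i IH] n q.
  by rewrite derivn0 exprS -mulrA hornerM hornerXsubC subrr mul0r.
by case: n => // n le_in; rewrite derivSn deriv_XsubC_expM IH.
Qed.

(** The summand of [delta] at [c_j] of order [i <= mu j] is killed by the factor
    [('X - c_j) ^ (mu j).+1] of [h]. *)
Lemma delta_vec_calPS (F : fieldType) M (c : 'I_M -> F) (mu : 'I_M -> nat) k :
  apply_vec (delta_vec c mu)
    (calP (\prod_(j < M) ('X - (c j)%:P) ^+ (mu j).+1) k.+1) = 0.
Proof.
apply/matrixP => i l; rewrite !mxE /delta_vec /calP.
rewrite exprS (bigD1 (tagnat.sig1 l)) //= -!mulrA.
exact: dirac_deriv_XsubC_expM.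
Qed.

Lemma apply_vec_perturb (F : fieldType) N (U V : 'I_N -> {scalar {poly F}})
    (L : 'M[F]_N) P :
  apply_vec (addfun_vec U (mulmx_vec L V)) P =
  apply_vec U P + apply_vec V P *m L^T.
Proof.
apply/matrixP => i j; rewrite !mxE /=; congr (_ + _); rewrite /lincomb.
by apply: eq_bigr => k _; rewrite !mxE mulrC.
Qed.

(** * Continuity and series in the complex plane *)

Section ComplexSequences.
Variable R : realType.
Local Notation C := R[i].

(** The norm of a complex number is itself an element of [R[i]]; its real part
    is the norm as a real number, to which real analysis applies. *)
Lemma Re_norm_real (x : C) : (complex.Re `|x|)%:C%C = `|x|.
Proof. by apply: RRe_real; rewrite normr_real. Qed.

Lemma Re_norm_le (x : C) (t : R) : complex.Re `|x| <= t -> `|x| <= t%:C%C.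
Proof. by rewrite -lecR Re_norm_real. Qed.

Lemma ReB (x y : C) : complex.Re (x - y) = complex.Re x - complex.Re y.
Proof. by case: x; case: y. Qed.

Lemma Re_sum n (u : nat -> C) :
  complex.Re (\sum_(0 <= k < n) u k) = \sum_(0 <= k < n) complex.Re (u k).
Proof.
elim: n => [|n IH]; first by rewrite !big_nil.
by rewrite !big_nat_recr //= -IH; case: (u n); case: (\sum_(_ <= _ < _) _).
Qed.

Lemma Im_sum n (u : nat -> C) :
  complex.Im (\sum_(0 <= k < n) u k) = \sum_(0 <= k < n) complex.Im (u k).
Proof.
elim: n => [|n IH]; first by rewrite !big_nil.
by rewrite !big_nat_recr //= -IH; case: (u n); case: (\sum_(_ <= _ < _) _).
Qed.

Lemma normc_ge_Im (x : C) : `|complex.Im x|%:C%C <= `|x|.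
Proof.
have -> : `|x| = `|x * 'i%C|.
  by rewrite normrM !normc_def /= expr0n /= expr1n add0r sqrtr1 mulr1.
by rewrite -normrN -ReiNIm normc_ge_Re.
Qed.

Lemma Re_norm_continuous : continuous (fun x : C^o => complex.Re `|x|).
Proof.
move=> x; apply/(@cvgrPdist_lt R R^o _ _ (nbhs_filter (x : C^o))) => /= e e0.
have := @norm_continuous C C^o x.
move/(@cvgrPdist_lt C C^o _ _ (nbhs_filter (x : C^o)))/(_ e%:C%C).
rewrite ltcR => /(_ e0); apply: (@filterS _ _ (nbhs_filter (x : C^o))) => y.
rewrite -ltcR; apply: le_lt_trans.
by have := normc_ge_Re (`|x| - `|y|); rewrite ReB.
Qed.

Lemma horner_continuous (p : {poly C}) :
  continuous (fun x : C^o => p.[x] : C^o).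
Proof.
elim/poly_ind: p => [|p a IH].
  rewrite [X in continuous X](_ : _ = cst 0); first exact: cst_continuous.
  by apply/funext => x; rewrite horner0.
rewrite [X in continuous X](_ : _ = (fun x : C^o => p.[x] * x + a : C^o)).
  move=> x; apply: (@continuousD C C^o C^o (fun x => p.[x] * x) (cst a)).
    by apply: (@continuousM C C^o (fun x => p.[x]) id); [exact: IH|].
  exact: cst_continuous.
by apply/funext => x; rewrite hornerMXaddC.
Qed.

Lemma Re_norm_horner_continuous (p : {poly C}) :
  continuous (fun x : C^o => complex.Re `|p.[x]|).
Proof.
move=> x; apply: (@continuous_comp _ _ _ (fun x : C^o => p.[x] : C^o)).
  exact: horner_continuous.
exact: Re_norm_continuous.
Qed.

(** The limit is assembled from the limits of the two parts, since
    [|x| <= |Re x| + |Im x|]. *)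
Lemma cvgn_complex (u : nat -> C^o) :
  cvgn (fun n => complex.Re (u n)) -> cvgn (fun n => complex.Im (u n)) ->
  cvgn u.
Proof.
move=> /cvg_ex[/= a ua] /cvg_ex[/= b ub]; apply/cvg_ex; exists (a +i* b)%C.
apply/cvgrPdist_lt => /= e; rewrite ltcE => /andP[/eqP /= e2 e1].
have {e2} -> : e = (complex.Re e)%:C%C by case: e e2 {e1} => ? ? /= ->.
have e1_2 : 0 < complex.Re e / 2 by rewrite divr_gt0.
near=> n.
have -> : (a +i* b)%C - u n =
    (a - complex.Re (u n))%:C%C + 'i%C * (b - complex.Im (u n))%:C%C.
  by case: (u n) => x y; rewrite [LHS]complexE.
apply: (le_lt_trans (ler_normD _ _)).
rewrite normrM !normc_def /= !expr0n /= expr1n add0r sqrtr1 mul1r !addr0.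
rewrite !sqrtr_sqr -raddfD ltcR [ltRHS](splitr (complex.Re e)) ltrD //.
- by near: n; move/cvgrPdist_lt : ua; apply.
- by near: n; move/cvgrPdist_lt : ub; apply.
Unshelve. all: by end_near. Qed.

(** The real and the imaginary part of each term are dominated by its norm,
    hence by a convergent geometric series of reals. *)
Lemma cvgn_series_complex (u : nat -> C^o) (A q : R) :
  0 <= q -> q < 1 -> (forall k, `|u k| <= (A * q ^+ k)%:C%C) ->
  cvgn (fun n => \sum_(0 <= k < n) u k).
Proof.
move=> q0 q1 leu.
have real_cvg (v : nat -> R) : (forall k, `|v k|%:C%C <= `|u k|) ->
    cvgn (series v).
  move=> lev; apply: normed_cvg.
  apply: (@series_le_cvg _ _ (geometric A q)) => //=.
  - by move=> n; rewrite -(@lecR R); apply: le_trans (leu n); apply: normr_ge0.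
  - by move=> n; rewrite -lecR (le_trans (lev n)).
  - by apply: is_cvg_geometric_series; rewrite ger0_norm.
apply: cvgn_complex.
- under eq_fun do rewrite Re_sum.
  by apply: real_cvg => k; apply: normc_ge_Re.
- under eq_fun do rewrite Im_sum.
  by apply: real_cvg => k; apply: normc_ge_Im.
Qed.

End ComplexSequences.

(** * Functionals carried by a compact set *)

Section Support.
Variable R : realType.
Local Notation C := R[i].
Variables (S : set C^o) (u : {scalar {poly C}}).
Hypothesis S_supp : is_support S u.

(** The empty set is an open neighbourhood of itself, on which the bound [B = 0]
    holds vacuously. *)
Lemma is_support0 p : S = set0 -> u p = 0.
Proof.
move=> S0; have [_ /(_ set0 open0)[|A leA]] := S_supp; first by rewrite S0.
by apply/eqP; rewrite -normr_le0 -(mulr0 A) leA.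
Qed.

(** The strict bound on [S] must be made uniform on a neighbourhood of [S]:
    [|h|] and [|p|] attain their maxima on the compact [S], and the sublevel sets
    of slightly larger values are open.  On their intersection
    [|h ^ k p| <= b q ^ k], to which the carrier estimate applies. *)
Lemma support_geometric_bound (h p : {poly C}) (r : R) :
  0 < r -> (forall x, S x -> `|h.[x]| < r%:C%C) ->
  exists A q, [/\ 0 <= q, q < r &
    forall k, `|u (h ^+ k * p)| <= (A * q ^+ k)%:C%C].
Proof.
move=> r0 h_lt; have [S0|/set0P S0] := eqVneq S set0.
  exists 0, 0; split => // k.
  by rewrite is_support0 // normr0 mul0r.
have [S_compact S_carrier] := S_supp.
have attains_max g : exists2 x, S x &
    forall y, S y -> complex.Re `|g.[y]| <= complex.Re `|g.[x]|.
  have [|x xS x_max] :=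
    @compact_EVT_max _ _ (fun x : C^o => complex.Re `|g.[x]|) S S0 S_compact.
    exact/continuous_subspaceT/Re_norm_horner_continuous.
  by exists x; [rewrite -inE | move=> y yS; apply: x_max; rewrite inE].
have [xh xhS h_max] := attains_max h; have [xp xpS p_max] := attains_max p.
have hxh_lt : complex.Re `|h.[xh]| < r by rewrite -ltcR Re_norm_real h_lt.
have hxh_ge0 : 0 <= complex.Re `|h.[xh]|.
  by rewrite -lecR Re_norm_real; apply: normr_ge0.
have pxp_ge0 : 0 <= complex.Re `|p.[xp]|.
  by rewrite -lecR Re_norm_real; apply: normr_ge0.
(* Any value strictly between the maximum of [|h|] and [r] would do for [q]. *)
set q := (complex.Re `|h.[xh]| + r) / 2; set b := complex.Re `|p.[xp]| + 1.
have q_ge0 : 0 <= q by rewrite divr_ge0 // addr_ge0 // ltW.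
have sublevel_open g (t : R) : open [set x : C^o | complex.Re `|g.[x]| < t].
  apply: (@open_comp _ _ (fun x : C^o => complex.Re `|g.[x]|) [set y | y < t]).
    by move=> x _; exact: Re_norm_horner_continuous.
  exact: open_lt.
have [] := S_carrier _ (openI (sublevel_open h q) (sublevel_open p b)).
  move=> x xS; split => /=.
    by rewrite (le_lt_trans (h_max x xS)) // midf_lt.
  by rewrite (le_lt_trans (p_max x xS)) // ltrDl.
move=> A leA; exists (complex.Re `|A| * b), q; split => //.
  by rewrite /q midf_lt.
move=> k; have : `|u (h ^+ k * p)| <= A * (b * q ^+ k)%:C%C.
  apply: leA; first by rewrite lecR mulr_ge0 ?exprn_ge0 // addr_ge0.
  move=> x [/= hx px]; rewrite hornerM horner_exp normrM normrX mulrC.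
  rewrite rmorphM rmorphXn /=; apply: ler_pM; rewrite ?exprn_ge0 //.
    exact/Re_norm_le/ltW.
  have h_le := Re_norm_le (ltW hx).
  by apply: lerXn2r; rewrite // nnegrE (le_trans _ h_le).
(* The carrier constant [A] may be any complex number; as [A b q ^ k]
   dominates a norm it is nonnegative, so [A] can be replaced by [|A|]. *)
move=> u_le; move: (u_le).
rewrite -(ger0_norm (le_trans (normr_ge0 _) u_le)) normrM {u_le} => u_le.
rewrite -mulrA rmorphM /= Re_norm_real.
have bq_ge0 : 0 <= b * q ^+ k by rewrite mulr_ge0 ?exprn_ge0 // addr_ge0.
by move: u_le; rewrite [X in _ <= _ * X]ger0_norm // (lecR 0).
Qed.

End Support.

(** * Markov functions *)

Section Markov.
Variables (R : realType) (N : nat) (h : {poly R[i]}).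
Local Notation C := R[i].
Implicit Types (U : 'I_N -> {scalar {poly C}}) (z : C).

(** No [x] satisfies [|h x| < 0], so a carrier admissible at [z = 0] is empty. *)
Lemma markov_domain0 U k : markov_domain h U 0 -> markov_coef h U k = 0.
Proof.
move=> [S [S_supp S_lt]]; apply/matrixP => i j; rewrite !mxE.
apply: (is_support0 (S_supp j)); rewrite -subset0 => x /S_lt.
by rewrite normr0 normr_lt0.
Qed.

(** For [z <> 0] the terms are dominated by a geometric series of ratio
    [q / |z| < 1]; for [z = 0] all of them vanish. *)
Lemma markov_domain_cvg U z : markov_domain h U z -> markov_cvg h U z.
Proof.
have [->|z0] := eqVneq z 0 => [/markov_domain0 U0|[S [S_supp S_lt]]] i j.
  rewrite /markov_partial [X in cvgn X](_ : _ = cst 0); first exact: is_cvg_cst.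
  by apply/funext => n; rewrite big1 // => k _; rewrite U0 mxE mulr0.
have z_gt0 : 0 < complex.Re `|z| by rewrite -ltcR Re_norm_real normr_gt0.
have [x|A [q [q_ge0 q_lt leA]]] :=
    @support_geometric_bound _ _ _ (S_supp j) h 'X^i _ z_gt0.
  by rewrite Re_norm_real; apply: S_lt.
apply: (@cvgn_series_complex R _
  ((complex.Re `|z|)^-1 * A) (q / complex.Re `|z|)).
- by rewrite divr_ge0 // ltW.
- by rewrite ltr_pdivrMr // mul1r.
- move=> k; rewrite mxE normrM normfV normrX -Re_norm_real -rmorphXn -fmorphV.
  set t := complex.Re `|z| in z_gt0 q_lt *.
  have -> : t^-1 * A * (q / t) ^+ k = (t ^+ k.+1)^-1 * (A * q ^+ k).
    rewrite exprS invfM expr_div_n -!mulrA; congr (_ * _).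
    by rewrite mulrA mulrC.
  rewrite rmorphM; apply: ler_wpM2l; last exact: leA.
  by rewrite (lecR 0) invr_ge0 exprn_ge0 // ltW.
Qed.

(** Dropping the term of index 0 from both series leaves equal tails, so the
    shifted partial sums differ by the constant [z^-1 D]. *)
Lemma markov_fun_perturb U V z (D : 'M[C]_N) :
  markov_cvg h U z ->
  markov_coef h V 0%N = markov_coef h U 0%N + D ->
  (forall k, markov_coef h V k.+1 = markov_coef h U k.+1) ->
  markov_fun h V z = markov_fun h U z + z^-1 *: D.
Proof.
move=> U_cvg V0 VS; apply/matrixP => i j; rewrite !mxE.
apply: (@cvg_lim C^o); first exact: norm_hausdorff.
rewrite -cvg_shiftS.
rewrite [X in X @ _ --> _](_ : _ =
    (fun n => markov_partial h U z i j n.+1 + z^-1 * D i j : C^o)).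
  apply: cvgD; last exact: cvg_cst.
  by rewrite cvg_shiftS; apply: U_cvg.
apply/funext => n /=; rewrite /markov_partial !big_nat_recl //.
rewrite V0 [(_ + D) i j]mxE mulrDr.
rewrite expr1 addrAC; congr (_ + _ + _).
by apply: eq_bigr => k _; rewrite VS.
Qed.

End Markov.

Theorem theorem5 (R : realType) (M : nat) (c : 'I_M -> R[i])
  (mu : 'I_M -> nat) (h : {poly R[i]})
  (U Ut : 'I_(\sum_(j < M) (mu j).+1) -> {scalar {poly R[i]}})
  (Lambda : 'M[R[i]]_(\sum_(j < M) (mu j).+1)) :
  injective c ->
  h = \prod_(j < M) ('X - (c j)%:P) ^+ (mu j).+1 ->
  quasi_definite h U ->
  Ut = addfun_vec U (mulmx_vec Lambda (delta_vec c mu)) ->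
  quasi_definite h Ut ->
  (* identity of formal series in 1/z: the coefficient of z^(-k) in z F(z) is
     markov_coef h U k *)
  (forall k : nat,
     markov_coef h Ut k = markov_coef h U k +
       (if k == 0%N then apply_vec (delta_vec c mu) (calP h 0) *m Lambda^T
        else 0)) /\
  (* identity of functions on the common domain *)
  (forall z : R[i], markov_domain h U z -> markov_domain h Ut z ->
     [/\ markov_cvg h U z, markov_cvg h Ut z &
       z *: markov_fun h Ut z = z *: markov_fun h U z +
         apply_vec (delta_vec c mu) (calP h 0) *m Lambda^T]).
Proof.
move=> _ h_def _ Ut_def _.
set D := apply_vec _ _ *m _.
have coef k :
    markov_coef h Ut k = markov_coef h U k + (if k == 0%N then D else 0).
  rewrite /markov_coef Ut_def apply_vec_perturb.
  by case: k => //= k; rewrite h_def delta_vec_calPS mul0mx.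
split=> // z Uz Utz; have U_cvg := markov_domain_cvg Uz.
split; [exact: U_cvg | exact: markov_domain_cvg |].
have [z0|z0] := eqVneq z 0.
  (* All coefficients of both series vanish, which forces [D = 0]. *)
  move: Uz Utz; rewrite z0 => /(markov_domain0 0) U0 /(markov_domain0 0).
  by rewrite coef U0 add0r /= => ->; rewrite !scale0r addr0.
rewrite (markov_fun_perturb U_cvg (coef 0%N)) => [|k].
  by rewrite scalerDr scalerA divff // scale1r.
by rewrite coef addr0.
Qed.
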